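(* Among all packings of circles of radius 1 in the Euclidean plane $E^2$, the closest packing is the regular hexagon packing, whose packing density equals $\frac{\pi}{\sqrt{12}}$; no packing of unit circles in the plane has packing density greater than $\frac{\pi}{\sqrt{12}}$.
   Context: A packing of unit circles is a family of discs of radius 1 in the plane with pairwise disjoint interiors; its packing density is the (upper) asymptotic proportion of the plane covered by the discs. The regular hexagon packing is the one obtained by tiling the plane with congruent regular hexagons circumscribed about unit circles and taking the inscribed unit circle of each hexagon. *)

(* Defs.v *)
From mathcomp Require Import all_boot all_order all_algebra.
From mathcomp Require Import all_classical all_reals all_analysis.
Import Order.TTheory GRing.Theory Num.Theory.
Import numFieldNormedType.Exports.

Set Implicit Arguments.
Unset Strict Implicit.
Unset Printing Implicit Defensive.

Local Open Scope classical_set_scope.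
Local Open Scope ring_scope.

(* The norm of the product R * R in the library is the sup norm, so the
   Euclidean distance is written out; the two induce the same topology, and
   [interior] below is the Euclidean interior. *)
Definition edist (R : realType) (p q : R * R) : R :=
  Num.sqrt ((p.1 - q.1) ^+ 2 + (p.2 - q.2) ^+ 2).

Definition disc (R : realType) (c : R * R) (r : R) : set (R * R) :=
  [set p | edist c p <= r].

Definition area (R : realType)
    (A : set (measurableTypeR R * measurableTypeR R)) : \bar R :=
  (@lebesgue_measure R \x @lebesgue_measure R)%E A.

(* A packing is given by its set of centers: two discs of a family with the
   same center overlap, so indexing the discs by their centers loses nothing. *)
Definition unit_circle_packing (R : realType) (C : set (R * R)) : Prop :=
  trivIset C (fun c => interior (disc c 1)).

Definition covered (R : realType) (C : set (R * R)) : set (R * R) :=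
  \bigcup_(c in C) disc c 1.

(* limsup, as r tends to infinity, of the proportion of the disc of radius r
   about the origin that is covered; both areas are finite, so [fine] is
   harmless. *)
Definition packing_density (R : realType) (C : set (R * R)) : \bar R :=
  limf_esup
    (fun r : R =>
       (fine (area (covered C `&` disc (0, 0) r)) /
        fine (area (disc (0, 0) r)))%:E)
    (pinfty_nbhs R).

(* The closed regular hexagon circumscribed about the unit circle of center c:
   the intersection of the half-planes containing that circle and bounded by
   its tangents at the six points of polar angle t + k * pi / 3. *)
Definition hexagon (R : realType) (c : R * R) (t : R) : set (R * R) :=
  [set p | forall k : 'I_6,
     (p.1 - c.1) * cos (t + k%:R * (pi / 3)) +
     (p.2 - c.2) * sin (t + k%:R * (pi / 3)) <= 1].

(* C is the set of centers of the tiles of a tiling of the plane by such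
   hexagons; t c gives the orientation of the tile centered at c. *)
Definition regular_hexagon_packing (R : realType) (C : set (R * R)) : Prop :=
  exists t : R * R -> R,
    \bigcup_(c in C) hexagon c (t c) = setT /\
    trivIset C (fun c => interior (hexagon c (t c))).

(* Main.v *)
(* Upper bound: grow every unit disc of the packing to radius T = 2 / sqrt 3 and
   give each center c the open truncated Voronoi cell of the points at distance
   < T from c that are nearer to c than to any other center.  The cell is the
   T-disc minus circular caps, one per neighboring center.  Three centers at
   mutual distance >= 2 do not fit in an open disc of radius T (the sum of the
   squared distances between three points is at most three times the sum of their
   squared distances to a fourth), so the sectors spanned by the caps are disjoint.  A
   cap at distance >= 1 takes at most the share 1 - kappa of its sector, where
   kappa = sin (pi / 3) / (pi / 3), so the cell keeps at least the area
   kappa * pi * T^2 = sqrt 12.  The cells are disjoint, hence at most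
   pi * (r + 3)^2 / sqrt 12 unit discs of the packing meet the disc of radius r.

   Lower bound: the hexagons of a tiling have area sqrt 12 in any orientation
   (rotations are products of shears, which preserve area by Fubini), and those
   whose inscribed circle lies in the disc of radius r cover the disc of radius
   r - 3. *)
Require Import Defs.
From mathcomp Require Import all_boot all_order all_algebra finmap.
From mathcomp Require Import all_classical all_reals all_analysis.
From mathcomp Require Import measurable_realfun ring lra.
Import Order.TTheory GRing.Theory Num.Theory.
Import numFieldNormedType.Exports.
Set Implicit Arguments.
Unset Strict Implicit.
Unset Printing Implicit Defensive.
Local Open Scope classical_set_scope.
Local Open Scope ring_scope.

(** * Translation invariance of Lebesgue measure and shear invariance of area *)

Section area_invariance.
Context {R : realType}.
Local Notation M := (measurableTypeR R).
Local Notation mu := (@lebesgue_measure R).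

(** The pushforward under a translation gives every half-open interval its length, and Lebesgue
    measure is determined by these values. *)
Lemma lebesgue_measure_shift (a : R) (A : set M) : measurable A ->
  mu ((fun x => x + a : M) @^-1` A) = mu A.
Proof.
move=> mA.
have mf : measurable_fun [set: M] (fun x => x + a : M).
  by apply: measurable_funD => //; exact: measurable_cst.
rewrite -[LHS]/(pushforward mu (fun x => x + a : M) A).
apply/esym/lebesgue_measure_unique => //= _ [[b c]] _ <-.
rewrite /pushforward.
have -> : (fun x : M => x + a : M) @^-1` `]b, c]%classic = `](b - a), (c - a)]%classic.
  by apply/seteqP; split => x /=; rewrite !in_itv/= ltrBlDr lerBrDr.
rewrite !lebesgue_measure_itv/= !lte_fin ltrD2r.
by case: ifPn => // _; rewrite -!EFinB; congr EFin; ring.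
Qed.

(** By Fubini: a vertical shear only translates each vertical section. *)
Lemma area_yshear (g : R -> R) (A : set (M * M)) :
  measurable_fun [set: M] (g : M -> M) -> measurable A ->
  area ((fun p : M * M => (p.1, p.2 + g p.1) : M * M) @^-1` A) = area A.
Proof.
move=> mg mA; apply: eq_integral => x _ /=.
rewrite -[RHS](lebesgue_measure_shift (g x)); last exact: measurable_xsection.
by congr (mu _); apply/seteqP; split => y /=; rewrite /xsection /= !inE.
Qed.

Lemma area_xshear (g : R -> R) (A : set (M * M)) :
  measurable_fun [set: M] (g : M -> M) -> measurable A ->
  area ((fun p : M * M => (p.1 + g p.2, p.2) : M * M) @^-1` A) = area A.
Proof.
move=> mg mA.
(* A horizontal shear translates horizontal sections, so area is rewritten as the integral in the
   other order; the two product measures agree on rectangles. *)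
have area2 (B : set (M * M)) : measurable B -> area B = (mu \x^ mu)%E B.
  move=> mB; apply: product_measure_unique => //= ? ? ? ?.
  by rewrite product_measure2E.
have mf : measurable_fun [set: M * M]
    (fun p : M * M => (p.1 + g p.2, p.2) : M * M).
  by apply: measurable_fun_pair => //; apply: measurable_funD => //;
    exact: measurableT_comp.
rewrite (area2 A mA) area2; last by rewrite -[X in measurable X]setTI; exact: mf.
apply: eq_integral => y _ /=.
rewrite -[RHS](lebesgue_measure_shift (g y)); last exact: measurable_ysection.
by congr (mu _); apply/seteqP; split => x /=; rewrite /ysection /= !inE.
Qed.
End area_invariance.

(** * Measurability of polynomial maps and of sets cut out by inequalities *)

Ltac solve_mfun := repeat lazymatch goal with
  | |- measurable_fun _ (fun x => GRing.add _ (GRing.opp _)) => apply: measurable_funB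
  | |- measurable_fun _ (fun x => GRing.add _ _) => apply: measurable_funD
  | |- measurable_fun _ (fun x => GRing.mul _ _) => apply: measurable_funM
  | |- measurable_fun _ (fun x => GRing.exp _ _) => apply: measurable_funX
  | |- measurable_fun _ (fun x => fst x) => exact: measurable_fst
  | |- measurable_fun _ (fun x => snd x) => exact: measurable_snd
  | |- measurable_fun _ fst => exact: measurable_fst
  | |- measurable_fun _ snd => exact: measurable_snd
  | |- measurable_fun _ (fun x => x) => exact: measurable_id
  | |- measurable_fun _ _ => exact: measurable_cst
  end.

Lemma measurable_set_ler d (T : measurableType d) (R : realType) (f g : T -> R) :
  measurable_fun [set: T] f -> measurable_fun [set: T] g ->
  measurable [set x | f x <= g x].
Proof.
move=> mf mg; rewrite -[X in measurable X]setTI.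
have m1 : measurable [set true] by [].
exact: (measurable_fun_ler mf mg measurableT m1).
Qed.

Lemma measurable_set_ltr d (T : measurableType d) (R : realType) (f g : T -> R) :
  measurable_fun [set: T] f -> measurable_fun [set: T] g ->
  measurable [set x | f x < g x].
Proof.
move=> mf mg; rewrite -[X in measurable X]setTI.
have m1 : measurable [set true] by [].
exact: (measurable_fun_ltr mf mg measurableT m1).
Qed.

(** * Translations and rotations preserve area *)

Section frames.
Context {R : realType}.
Local Notation M := (measurableTypeR R).
Local Notation P := (M * M)%type.

(** For a unit vector [u], these are the coordinates of [p] in the orthonormal frame with origin [c]
    and axes [u] and [(- u.2, u.1)]. *)
Definition frame (c u : R * R) (p : R * R) : R * R :=
  ((p.1 - c.1) * u.1 + (p.2 - c.2) * u.2,
   (p.2 - c.2) * u.1 - (p.1 - c.1) * u.2).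

Lemma measurable_frame (c u : R * R) :
  measurable_fun [set: P] (frame c u : P -> P).
Proof. by apply: measurable_fun_pair => /=; solve_mfun. Qed.

Lemma measurable_frame_preimage (c u : R * R) (A : set P) :
  measurable A -> measurable ((frame c u : P -> P) @^-1` A).
Proof.
by move=> mA; rewrite -[X in measurable X]setTI; exact: measurable_frame.
Qed.

(** For [u] of polar angle theta, the rotation is a product of three shears, with factors [s] = tan
    (theta / 2), - sin theta and [s] again. At the half turn [s] would be infinite. *)
Let area_frame0 (u : R * R) (A : set P) : u.1 ^+ 2 + u.2 ^+ 2 = 1 ->
  u.1 != -1 -> measurable A ->
  area ((frame (0, 0) u : P -> P) @^-1` A) = area A.
Proof.
case: u => a b /= ab1 aN1 mA; have a1 : 1 + a != 0.
  by apply: contra_neq aN1 => a1; lra.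
pose s := b / (1 + a).
have mlin (k : R) : measurable_fun [set: M] ((fun y : R => k * y) : M -> M).
  by solve_mfun.
have mx (k : R) B : measurable B ->
    measurable ((fun p : P => (p.1 + k * p.2, p.2) : P) @^-1` B).
  move=> mB; rewrite -[X in measurable X]setTI; apply: (_ : measurable_fun _ _) => //.
  by apply: measurable_fun_pair => /=; solve_mfun.
have my (k : R) B : measurable B ->
    measurable ((fun p : P => (p.1, p.2 + k * p.1) : P) @^-1` B).
  move=> mB; rewrite -[X in measurable X]setTI; apply: (_ : measurable_fun _ _) => //.
  by apply: measurable_fun_pair => /=; solve_mfun.
have -> : (frame (0, 0) (a, b) : P -> P) =
    (fun p => (p.1 + s * p.2, p.2)) \o ((fun p => (p.1, p.2 + (- b) * p.1)) \o
    (fun p => (p.1 + s * p.2, p.2))).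
  have bs : b * s = 1 - a.
    rewrite /s mulrA -expr2 (_ : b ^+ 2 = (1 - a) * (1 + a)); last by lra.
    by rewrite mulfK.
  have sa : s * (1 + a) = b by rewrite /s divfK.
  apply/funext => -[x y]; rewrite /frame /=; congr pair.
    rewrite -[in LHS]sa -[in LHS](subKr 1 a) -bs; ring.
  rewrite [in LHS](_ : a = 1 - b * s); last by lra.
  ring.
rewrite !comp_preimage (area_xshear (mlin s)); last by apply: my; apply: mx.
rewrite (area_yshear (mlin (- b))); last by apply: mx.
by rewrite (area_xshear (mlin s)).
Qed.

Lemma area_frame (c u : R * R) (A : set P) : u.1 ^+ 2 + u.2 ^+ 2 = 1 ->
  measurable A -> area ((frame c u : P -> P) @^-1` A) = area A.
Proof.
move=> u1 mA.
have area_origin B : measurable B ->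
    area ((frame c (1, 0) : P -> P) @^-1` B) = area B.
  move=> mB.
  have -> : (frame c (1, 0) : P -> P) =
      (fun p => (p.1 + cst (- c.1) p.2, p.2)) \o
      (fun p => (p.1, p.2 + cst (- c.2) p.1)).
    by apply/funext => -[x y]; rewrite /frame /=; congr pair; ring.
  rewrite comp_preimage area_yshear ?area_xshear //.
  rewrite -[X in measurable X]setTI; apply: (_ : measurable_fun _ _) => //.
  by apply: measurable_fun_pair => /=; solve_mfun.
have -> : (frame c u : P -> P) = frame (0, 0) u \o frame c (1, 0).
  by apply/funext => p; rewrite /frame /=; congr pair; ring.
rewrite comp_preimage area_origin; last exact: measurable_frame_preimage.
have [uN1|uN1] := eqVneq u.1 (-1); last exact: area_frame0.
have u2 : u.2 = 0 by apply/eqP; rewrite -sqrf_eq0; apply/eqP; rewrite uN1 in u1; lra.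
(* The half turn is the square of a quarter turn, to which the three shears apply. *)
have -> : (frame (0, 0) u : P -> P) = frame (0, 0) (0, 1) \o frame (0, 0) (0, 1).
  by apply/funext => p; rewrite /frame /= uN1 u2; congr pair; ring.
rewrite comp_preimage !area_frame0 //=; try by rewrite expr0n/= expr1n add0r.
- by lra.
- by lra.
- exact: measurable_frame_preimage.
Qed.
End frames.

(** * Integrals of affine functions and of the circular profile *)

Section integrals.
Context {R : realType}.
Local Notation M := (measurableTypeR R).
Local Notation P := (M * M)%type.
Local Notation mu := (@lebesgue_measure R).

Lemma integral_is_derive (a b : R) (f F : R -> R) : a < b -> continuous f ->
  (forall x : R, is_derive x 1 F (f x)) ->
  (\int[mu]_(x in `[a, b]) (f x)%:E = (F b - F a)%:E)%E.
Proof.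
move=> ab cf dF; have cF : continuous F.
  by move=> x; apply/differentiable_continuous/derivable1_diffP; exact: ex_derive.
rewrite (continuous_FTC2 (F := F)) //; first exact: continuous_subspaceT.
- by split => [x _||]; [exact: ex_derive| apply: cvg_at_right_filter; exact: cF
    | apply: cvg_at_left_filter; exact: cF].
- by move=> x _; rewrite derive1E derive_val.
Qed.

Lemma integral_affine (a b c d : R) : a < b ->
  (\int[mu]_(x in `[a, b]) (c + d * x)%:E =
   (c * (b - a) + d * (b ^+ 2 - a ^+ 2) / 2)%:E)%E.
Proof.
move=> ab.
pose F (x : R) := c * x + d / 2 * x ^+ 2.
have dF (x : R) : is_derive x 1 F (c + d * x).
  by apply: is_derive_eq; rewrite /GRing.scale /=; field.
rewrite (integral_is_derive ab _ dF); first by congr EFin; rewrite /F; field.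
by move=> x; apply: cvgD; [exact: cvg_cst | apply: cvgM => //; exact: cvg_cst].
Qed.

(** The substitution x = r sin t turns the integrand into 2 r^2 cos^2 t, with antiderivative r^2 (t
    + sin t cos t). *)
Lemma integral_circular_cap (r a : R) : 0 < r -> - (pi / 2) <= a < pi / 2 ->
  (\int[mu]_(x in `[(r * sin a)%R, r]) (2 * Num.sqrt (r ^+ 2 - x ^+ 2))%:E =
   (r ^+ 2 * (pi / 2 - a - sin a * cos a))%:E)%E.
Proof.
move=> r0 /andP[aN ap].
pose F (t : R) := r * sin t.
have dF (t : R) : is_derive t 1 F (r * cos t) by apply: is_derive_eq; rewrite /GRing.scale /=; ring.
have cF : continuous F.
  by move=> x; apply/differentiable_continuous/derivable1_diffP; exact: ex_derive.
have F'E : F^`()%classic = fun t => r * cos t.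
  by apply/funext => t; rewrite derive1E derive_val.
have cF' : continuous (fun t : R => r * cos t).
  by move=> x; apply: cvgM; [exact: cvg_cst|exact: continuous_cos].
have -> : (\int[mu]_(x in `[(r * sin a)%R, r]) (2 * Num.sqrt (r ^+ 2 - x ^+ 2))%:E =
  \int[mu]_(x in `[F a, F (pi / 2)%R]) (2 * Num.sqrt (r ^+ 2 - x ^+ 2))%:E)%E.
  by rewrite /F sin_pihalf mulr1.
rewrite integration_by_substitution_increasing //.
- rewrite -[RHS](_ : (r ^+ 2 * (pi / 2 + sin (pi / 2) * cos (pi / 2))
     - r ^+ 2 * (a + sin a * cos a))%:E = _); last first.
    by rewrite cos_pihalf; congr EFin; ring.
  pose G (t : R) := r ^+ 2 * (t + sin t * cos t).
  have dG (t : R) : is_derive t 1 G (2 * r ^+ 2 * (cos t) ^+ 2).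
    apply: is_derive_eq; rewrite /GRing.scale /=.
    by rewrite -[X in r ^+ 2 * (X + _) = _](cos2Dsin2 t); ring.
  rewrite [RHS](_ : _ = (G (pi / 2) - G a)%:E); last first.
    by rewrite /G cos_pihalf; congr EFin; ring.
  rewrite -(integral_is_derive ap _ dG).
  + apply: eq_integral => t; rewrite inE /= in_itv /= => /andP[at1 tp].
    congr EFin; rewrite F'E !fctE /F.
    have -> : r ^+ 2 - (r * sin t) ^+ 2 = (r * cos t) ^+ 2.
      by rewrite !exprMn -[X in X - _ = _](mulr1) -(cos2Dsin2 t); ring.
    rewrite sqrtr_sqr ger0_norm; first by ring.
    rewrite mulr_ge0 ?(ltW r0) // cos_ge0_pihalf // tp andbT.
    exact: le_trans at1.
  + move=> x; apply: cvgM; first exact: cvg_cst.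
    by apply: cvgM; exact: continuous_cos.
- exact: ltW.
- move=> x y; rewrite !in_itv /= => /andP[ax xp] /andP[ay yp] xy.
  rewrite /F ltr_pM2l // ltr_sin // in_itv /= ?xp ?yp andbT; exact: le_trans aN _.
- by rewrite F'E => x _; exact: cF'.
- rewrite F'E; apply/cvg_ex; exists (r * cos a); apply: cvg_at_right_filter; exact: cF'.
- rewrite F'E; apply/cvg_ex; exists (r * cos (pi / 2)); apply: cvg_at_left_filter; exact: cF'.
- by split => [x _||]; [exact: ex_derive| apply: cvg_at_right_filter; exact: cF
    | apply: cvg_at_left_filter; exact: cF].
- apply: continuous_subspaceT => x; apply: cvgM; first exact: cvg_cst.
  have cs : continuous (fun y : R => r ^+ 2 - y ^+ 2).
    by move=> y; apply: cvgB; [exact: cvg_cst|apply: cvgM].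
  exact: (cvg_comp _ _ (cs x) (@sqrt_continuous R _)).
Qed.

End integrals.

(** * Areas of caps, discs, triangles and the hexagon *)

Section areas.
Context {R : realType}.
Local Notation M := (measurableTypeR R).
Local Notation P := (M * M)%type.
Local Notation mu := (@lebesgue_measure R).

(** Vertical sections are intervals symmetric about 0. Whether they contain their endpoints, which
    [b] decides, does not affect their length, so open and closed regions are handled together. *)
Lemma area_symmetric (b : bool) (D : set R) (g : R -> R) (A : set P) :
  (forall x, D x -> 0 <= g x) ->
  (forall x y, A (x, y) <-> D x /\ `|y| < g x ?<= if b) ->
  area A = (\int[mu]_(x in D) (2 * g x)%:E)%E.
Proof.
move=> g0 AE; rewrite [RHS]integral_mkcond; apply: eq_integral => x _ /=.
rewrite patchE; case: ifPn => [|] xD.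
  rewrite inE in xD.
  have -> : xsection A x = [set` Interval (BSide b (- g x)) (BSide (~~ b) (g x))].
    apply/seteqP; split => y /=; rewrite /xsection /= in_setE in_itv /= negbK.
      by move=> /AE[_]; rewrite lteif_norml.
    by rewrite -lteif_norml => ?; apply/AE.
  rewrite lebesgue_measure_itv /= lte_fin.
  have := g0 _ xD; rewrite le_eqVlt => /predU1P[<-|gx].
    by rewrite oppr0 ltxx mulr0.
  by rewrite gtrN// -EFinB; congr EFin; ring.
have -> : xsection A x = set0; last by rewrite measure0.
apply/seteqP; split => y //=; rewrite /xsection /= inE => /AE[xD' _].
by move: xD; rewrite notin_setE.
Qed.

Lemma lteif_sqr (b : bool) (x y : R) : 0 <= y ->
  (x ^+ 2 < y ^+ 2 ?<= if b) = (`|x| < y ?<= if b).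
Proof.
move=> y0; rewrite -real_normK ?num_real //.
by case: b => /=; rewrite ?ler_pXn2r ?ltr_pXn2r ?nnegrE.
Qed.

Lemma area_circular_cap (b : bool) (r a : R) : 0 < r -> - (pi / 2) <= a < pi / 2 ->
  area ([set p | r * sin a <= p.1 /\ p.1 ^+ 2 + p.2 ^+ 2 < r ^+ 2 ?<= if b] : set P)
  = (r ^+ 2 * (pi / 2 - a - sin a * cos a))%:E.
Proof.
move=> r0 aP.
rewrite (@area_symmetric b `[r * sin a, r] (fun x => Num.sqrt (r ^+ 2 - x ^+ 2))).
- exact: integral_circular_cap.
- by move=> x _; exact: sqrtr_ge0.
move=> x y /=; rewrite in_itv /= -lteif_sqr ?sqrtr_ge0 //.
have sN1 : - r <= r * sin a by have := sin_geN1 a; nra.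
split=> [[rx xy]|[/andP[rx xr]]].
  have xr : x <= r.
    have : x ^+ 2 <= r ^+ 2 by case: b xy => /= xy; have := sqr_ge0 y; lra.
    by rewrite [x <= r]leNgt => ?; apply/negP => ?; nra.
  rewrite rx xr; split => //; rewrite sqr_sqrtr; last by nra.
  by case: b xy => /=; lra.
rewrite sqr_sqrtr; last by nra.
by move=> xy; split => //; case: b xy => /=; lra.
Qed.

(** The disc is the cap with [a = - (pi / 2)], cut off by a tangent line. *)
Lemma area_disc_lteif (b : bool) (r : R) : 0 < r ->
  area ([set p | p.1 ^+ 2 + p.2 ^+ 2 < r ^+ 2 ?<= if b] : set P)
  = (pi * r ^+ 2)%:E.
Proof.
move=> r0; have p0 := pi_gt0 R.
have := @area_circular_cap b r (- (pi / 2)) r0.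
rewrite sinN cosN sin_pihalf cos_pihalf => aE.
rewrite -[RHS](_ : (r ^+ 2 * (pi / 2 - - (pi / 2) - -1 * 0))%:E = _); last first.
  by congr EFin; field.
rewrite -aE; last by lra.
congr area; apply/seteqP; split => -[x y] /=; last by case.
move=> xy; split => //.
have : x ^+ 2 <= r ^+ 2 by case: b xy {aE} => /= xy; have := sqr_ge0 y; lra.
by nra.
Qed.

Lemma area_isosceles_triangle (h k : R) : 0 < h -> 0 <= k ->
  area ([set p | 0 <= p.1 < h /\ `|p.2| < k / h * p.1] : set P) = (h * k)%:E.
Proof.
move=> h0 k0.
rewrite (@area_symmetric false `[0, h[ (fun x => k / h * x)).
- have ac : continuous (fun x : R => 2 * (k / h * x)).
    move=> x; apply: cvgM; first exact: cvg_cst.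
    by apply: cvgM => //; exact: cvg_cst.
  rewrite integral_itv_bndo_bndc; last first.
    apply/measurable_EFinP; apply: measurable_funTS.
    exact: continuous_measurable_fun.
  rewrite -[RHS](_ : (0 * (h - 0) + 2 * (k / h) * (h ^+ 2 - 0 ^+ 2) / 2)%:E = _).
    rewrite -integral_affine //; apply: eq_integral => x _; congr EFin; ring.
  by congr EFin; field; rewrite gt_eqF.
- by move=> x /=; rewrite in_itv /= => /andP[x0 _]; rewrite mulr_ge0 // divr_ge0 // ltW.
by move=> x y /=; rewrite in_itv.
Qed.

(** The hexagon about the origin in orientation 0: opposite half-planes are merged into strips, and
    the oblique inequalities are doubled to clear cos (pi / 3) = 1 / 2. *)
Definition hexagon0 : set P := [set p | [/\ `|p.1| <= 1,
  `|p.1 + Num.sqrt 3 * p.2| <= 2 & `|p.1 - Num.sqrt 3 * p.2| <= 2]].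

Lemma measurable_hexagon0 : measurable hexagon0.
Proof.
have mfun (f : P -> R) (e : R) : measurable_fun [set: P] f ->
    measurable [set p : P | `|f p| <= e].
  by move=> mf; apply: measurable_set_ler => //; exact: measurableT_comp.
rewrite (_ : hexagon0 = [set p : P | `|p.1| <= 1] `&`
  [set p : P | `|p.1 + Num.sqrt 3 * p.2| <= 2] `&`
  [set p : P | `|p.1 - Num.sqrt 3 * p.2| <= 2]).
  by apply: measurableI; [apply: measurableI|]; apply: mfun; solve_mfun.
by apply/seteqP; split => p /=; [move=> [] | move=> [[]]].
Qed.

Lemma area_hexagon0 : (area hexagon0 <= (Num.sqrt 12)%:E)%E.
Proof.
rewrite /hexagon0; set s := Num.sqrt 3; set H := (X in area X).
have s0 : 0 < s by rewrite sqrtr_gt0.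
have s2 : s ^+ 2 = 3 by rewrite sqr_sqrtr.
(* The sign [e] selects the right or left half, where the hexagon is bounded by
   [|p.2| <= (2 - e * p.1) / s]. The halves share a segment, so they are joined by subadditivity. *)
have half (e : R) : e = 1 \/ e = -1 ->
    area (H `&` [set p | 0 <= e * p.1]) = s%:E.
  move=> e1.
  have e2 : e ^+ 2 = 1 by case: e1 => ->; ring.
  rewrite (@area_symmetric true (if e == 1 then `[0, 1]%classic else `[-1, 0]%classic)
    (fun x => (2 - e * x) / s)).
  - rewrite [in RHS](_ : s = 3 / s); last by rewrite -s2; field; rewrite gt_eqF.
    case: e1 => -> /=; [rewrite eqxx|rewrite ifF; last by lra].
    + rewrite -[RHS](_ : (4 / s * (1 - 0) + (- 2 / s) * (1 ^+ 2 - 0 ^+ 2) / 2)%:E = _).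
        by rewrite -integral_affine //; apply: eq_integral => x _; congr EFin; field; rewrite gt_eqF.
      by congr EFin; field; rewrite gt_eqF.
    + rewrite -[RHS](_ : (4 / s * (0 - -1) + (2 / s) * (0 ^+ 2 - (-1) ^+ 2) / 2)%:E = _).
        by rewrite -integral_affine ?ltrN10 //; apply: eq_integral => x _; congr EFin; field; rewrite gt_eqF.
      by congr EFin; field; rewrite gt_eqF.
  - move=> x; case: e1 => -> /=; [rewrite eqxx|rewrite ifF; last by lra];
      rewrite /= in_itv /= => /andP[x1 x2]; apply: divr_ge0; lra.
  - move=> x y; rewrite /H /= ler_pdivlMr //.
    have sy : `|y| * s = `|s * y| by rewrite normrM (gtr0_norm s0) mulrC.
    rewrite sy; set z := s * y.
    split=> [[[]]|].
      rewrite !ler_norml => /andP[x1 x2] /andP[x3 x4] /andP[x5 x6] ex.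
      case: e1 ex => -> /= ex; [rewrite eqxx|rewrite ifF; last by lra];
        rewrite /= in_itv /=; split; apply/andP; split; lra.
    case: e1 => -> /=; [rewrite eqxx|rewrite ifF; last by lra];
      rewrite /= in_itv /= !ler_norml => -[/andP[x1 x2] /andP[x3 x4]];
      split; try lra; split; apply/andP; split; lra.
have mH : measurable H := measurable_hexagon0.
have mh (e : R) : measurable [set p : P | 0 <= e * p.1].
  by apply: measurable_set_ler; solve_mfun.
have HU : H = (H `&` [set p | 0 <= 1 * p.1]) `|` (H `&` [set p | 0 <= -1 * p.1]).
  rewrite -setIUr; apply/seteqP; split => [p Hp|p []//]; split => //=.
  by have [p1|/ltW p1] := leP 0 p.1; [left|right]; lra.
rewrite HU; apply: (le_trans (measureU2 _ _ _)).
- exact: measurableI.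
- exact: measurableI.
rewrite [X in (X + _)%E]half ?[X in (_ + X)%E]half; [|by right|by left].
rewrite -EFinD lee_fin (_ : 12 = 3 * 2 ^+ 2); last by ring.
by rewrite sqrtrM // sqrtr_sqr ger0_norm // -/s; lra.
Qed.
End areas.

(** * Values at pi / 3 and pi / 6, and a chord bound *)

Section trigonometry.
Context {R : realType}.

(** The triple angle formula gives 4 c^3 - 3 c + 1 = 0, that is (c + 1) (2 c - 1)^2 = 0, and c is
    positive. *)
Lemma cos_pi3 : cos (pi / 3) = 1 / 2 :> R.
Proof.
have p0 := pi_gt0 R; pose c : R := cos (pi / 3); pose s : R := sin (pi / 3); rewrite -/c.
have c0 : 0 < c by apply: cos_gt0_pihalf; lra.
have cs : c ^+ 2 + s ^+ 2 = 1 := cos2Dsin2 _.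
have : cos (pi / 3 + pi / 3 + pi / 3) = -1 :> R by rewrite -cospi; congr cos; field.
rewrite !cosD sinD -/c -/s => c3.
have : (c + 1) * (2 * c - 1) ^+ 2 = 0.
  have s2 : s ^+ 2 = 1 - c ^+ 2 by lra.
  have : c * c * c - s * s * c - (c * s + s * c) * s = 4 * c ^+ 3 - 3 * c.
    have -> : c * c * c - s * s * c - (c * s + s * c) * s = c ^+ 3 - 3 * c * s ^+ 2 by ring.
    by rewrite s2; ring.
  have -> : (c + 1) * (2 * c - 1) ^+ 2 = 4 * c ^+ 3 - 3 * c + 1 by ring.
  by move=> <-; rewrite -[RHS](subrr (-1)) -{1}c3; ring.
move=> /eqP; rewrite mulf_eq0 expf_eq0 /= => /orP[|] /eqP; lra.
Qed.

Lemma sin_pi3 : sin (pi / 3) = Num.sqrt 3 / 2 :> R.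
Proof.
have p0 := pi_gt0 R.
have s0 : 0 < sin (pi / 3) :> R by apply: sin_gt0_pi; lra.
have s3 : 0 <= Num.sqrt 3 :> R := sqrtr_ge0 _.
have : sin (pi / 3) ^+ 2 = (Num.sqrt 3 / 2) ^+ 2 :> R.
  by rewrite sin2cos2 cos_pi3 [RHS]exprMn sqr_sqrtr //; field.
by move=> ?; apply/le_anti/andP; split; nra.
Qed.

Lemma cos_pi6 : cos (pi / 6) = Num.sqrt 3 / 2 :> R.
Proof. by rewrite -sin_pi3 -cosBpihalf -cosN; congr cos; field. Qed.

Lemma sin_pi6 : sin (pi / 6) = 1 / 2 :> R.
Proof. by rewrite -cosBpihalf -cos_pi3 -[RHS]cosN; congr cos; field. Qed.

(* The left-hand side is the chord over [[0, pi / 6]] of the concave right-hand side. *)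
Lemma sin_cos_chord (x : R) : 0 <= x <= pi / 6 ->
  3 * Num.sqrt 3 / (2 * pi) * x <= sin x * cos x.
Proof.
have p0 := pi_gt0 R.
move=> /andP[]; rewrite le_eqVlt => /predU1P[<-|x0]; first by rewrite sin0 mulr0 mul0r.
rewrite le_eqVlt => /predU1P[->|x6].
  rewrite sin_pi6 cos_pi6 le_eqVlt; apply/orP; left; apply/eqP.
  move: p0; generalize (pi : R) => q q0; field.
  by rewrite gt_eqF.
pose g (t : R) := sin t * cos t.
have dg (t : R) : is_derive t 1 g (1 - 2 * sin t ^+ 2).
  apply: is_derive_eq; rewrite /GRing.scale /=.
  by rewrite -[X in _ = X - _](cos2Dsin2 t); ring.
have cg a b : {within `[a, b], continuous g}.
  by apply: derivable_within_continuous => t _; exact: ex_derive.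
(* Concavity enters through two mean values: the slope of [g] over [[0, x]] is at least its slope
   over [[x, pi / 6]], hence at least the slope over [[0, pi / 6]]. *)
have [c1] := MVT x0 (fun t _ => dg t) (cg _ _).
rewrite in_itv /= => /andP[c10 c1x].
have [c2] := MVT x6 (fun t _ => dg t) (cg _ _).
rewrite in_itv /= => /andP[c2x c26].
have s12 : sin c1 <= sin c2.
  by apply: ltW; rewrite ltr_sin ?in_itv /=; try apply/andP; try split; lra.
have s1 : 0 <= sin c1 by apply: sin_ge0_pi; lra.
rewrite {2 4}/g sin0 mul0r !subr0 {1}/g sin_pi6 cos_pi6 => g2 g1.
rewrite -/(g x) g1 in g2 *.
have : sin c1 ^+ 2 <= sin c2 ^+ 2 by nra.
set m1 := 1 - 2 * sin c1 ^+ 2 in g2 *; move=> s2.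
rewrite ler_pM2r //.
have : Num.sqrt 3 / 4 <= m1 * (pi / 6).
  have -> : Num.sqrt 3 / 4 = m1 * x + (1 - 2 * sin c2 ^+ 2) * (pi / 6 - x) :> R.
    by rewrite -g2; field.
  have : 0 < pi / 6 - x by lra.
  rewrite /m1; nra.
move=> h; rewrite ler_pdivrMr; last by lra.
lra.
Qed.
End trigonometry.

(** * The share of a sector taken by its cap *)

Section cap_in_sector.
Context {R : realType}.
Local Notation M := (measurableTypeR R).
Local Notation P := (M * M)%type.

(** Here 4 / 3 is T^2 for T = 2 / sqrt 3, the circumradius of the hexagon about a unit circle. The
    chord belongs to the cap, so points on a bisector will be removed from both cells. *)
Definition cap0 (h : R) : set P :=
  [set p | h <= p.1 /\ p.1 ^+ 2 + p.2 ^+ 2 < 4 / 3].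

(** For [h >= 0] the first two conditions say that the cosine of the polar angle exceeds h / T:
    these are the directions that meet the interior of the chord at distance [h]. *)
Definition sector0 (h : R) : set P :=
  [set p | [/\ 0 < p.1, h ^+ 2 * (p.1 ^+ 2 + p.2 ^+ 2) < 4 / 3 * p.1 ^+ 2 &
     p.1 ^+ 2 + p.2 ^+ 2 < 4 / 3]].

(* [sin (pi / 3) / (pi / 3)]: the share of a circular sector of angle [pi / 3]
   covered by its triangle; narrower sectors have a larger share. *)
Definition kappa : R := 3 * Num.sqrt 3 / (2 * pi).

Lemma kappa_le1 : kappa <= 1.
Proof.
have p0 := pi_gt0 R.
have p3 : 0 < pi / 3 :> R by lra.
have cs : {within `[0, pi / 3], continuous (@sin R)}.
  by apply: derivable_within_continuous => t _; exact: ex_derive.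
have [c _] := MVT p3 (fun t _ => is_derive_sin t) cs.
rewrite sin0 !subr0 sin_pi3 => s3.
rewrite /kappa ler_pdivrMr; last by lra.
have := cos_le1 c; nra.
Qed.

Lemma measurable_cap0 (h : R) : measurable (cap0 h).
Proof.
rewrite (_ : cap0 h = [set p : P | h <= p.1] `&` [set p | p.1 ^+ 2 + p.2 ^+ 2 < 4 / 3]).
  by apply: measurableI; [apply: measurable_set_ler|apply: measurable_set_ltr]; solve_mfun.
by apply/seteqP; split.
Qed.

Lemma measurable_sector0 (h : R) : measurable (sector0 h).
Proof.
rewrite (_ : sector0 h = [set p : P | 0 < p.1] `&`
    [set p | h ^+ 2 * (p.1 ^+ 2 + p.2 ^+ 2) < 4 / 3 * p.1 ^+ 2] `&`
    [set p | p.1 ^+ 2 + p.2 ^+ 2 < 4 / 3]).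
  by apply: measurableI; [apply: measurableI|];
    apply: measurable_set_ltr; solve_mfun.
by apply/seteqP; split => p /=; [case|case => -[]].
Qed.

Lemma cap0_sub_sector0 (h : R) : 0 < h -> cap0 h `<=` sector0 h.
Proof.
rewrite /cap0 /sector0 => h0 [x y] /= [hx xy]; split => /=; [lra| |exact: xy].
have x2 : 0 < x ^+ 2 by rewrite exprn_gt0 //; lra.
have : h ^+ 2 <= x ^+ 2 by nra.
have := sqr_ge0 y; nra.
Qed.

(** Let [x] be the half-angle of the sector, cos x = h / T. The cap has area T^2 (x - sin x cos x),
    and sin x cos x >= kappa x by the chord bound, so the cap has area at most (1 - kappa) T^2 x. *)
Lemma area_cap0_le (h : R) : 1 <= h ->
  (area (cap0 h) <= (1 - kappa)%:E * area (sector0 h))%E.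
Proof.
move=> h1; have p0 := pi_gt0 R.
pose T : R := Num.sqrt (4 / 3).
have T0 : 0 < T by rewrite sqrtr_gt0; lra.
have T2 : T ^+ 2 = 4 / 3 by rewrite sqr_sqrtr //; lra.
have T3 : T * Num.sqrt 3 = 2.
  by rewrite -sqrtrM; [rewrite (_ : 4 / 3 * 3 = 2 ^+ 2) ?sqrtr_sqr ?ger0_norm //; field|lra].
have s3 : Num.sqrt 3 ^+ 2 = 3 :> R by rewrite sqr_sqrtr.
(* If [T <= h], the line p.1 = h misses the open disc and the cap is empty. *)
have [hT|Th] := leP T h.
  have -> : cap0 h = set0.
    rewrite /cap0 -T2; apply/seteqP; split => -[x y] //= [hx].
    have := sqr_ge0 y; nra.
  rewrite [area set0]measure0 mule_ge0 ?measure_ge0 // lee_fin subr_ge0.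
  exact: kappa_le1.
pose x := acos (h / T).
have hT1 : -1 <= h / T <= 1.
  have : 0 <= h / T by rewrite divr_ge0 // ltW //; lra.
  have : h / T < 1 by rewrite ltr_pdivrMr // mul1r.
  by move=> ? ?; apply/andP; split; lra.
have cx : cos x = h / T by apply: acosK; rewrite in_itv.
have x0 : 0 < x.
  by apply: acos_gt0; case/andP: hT1 => -> _; rewrite ltr_pdivrMr ?mul1r.
have xp : x <= pi by exact: acos_lepi.
(* This is where [1 <= h] is used, since T cos (pi / 6) = 1. *)
have x6 : x <= pi / 6.
  rewrite leNgt; apply/negP => x6.
  have : cos x < cos (pi / 6) by rewrite ltr_cos // in_itv /=; apply/andP; split; lra.
  rewrite cx cos_pi6 ltr_pdivrMr //; lra.
pose k := T * sin x.
have sx : 0 <= sin x by apply: sin_ge0_pi; lra.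
have k0 : 0 <= k by rewrite mulr_ge0 // ltW.
have hk : h = T * cos x by rewrite cx mulrC divfK // gt_eqF.
have hk2 : h ^+ 2 + k ^+ 2 = 4 / 3.
  by rewrite -T2 hk !exprMn -mulrDr cos2Dsin2 mulr1.
set S := sector0 h.
pose Tr : set P := [set p | 0 <= p.1 < h /\ `|p.2| < k / h * p.1].
have aC : area (cap0 h) = (T ^+ 2 * (x - sin x * cos x))%:E.
  have := @area_circular_cap R false T (pi / 2 - x) T0.
  rewrite sinB cosB sin_pihalf cos_pihalf !mul0r mul1r subr0 add0r mul1r -hk T2 /= => ->.
    by congr (_ * _)%:E; ring.
  lra.
have aT : area Tr = (h * k)%:E by apply: area_isosceles_triangle; lra.
have mT : measurable Tr.
  rewrite (_ : Tr = [set p : P | 0 <= p.1] `&` [set p : P | p.1 < h] `&`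
     [set p | `|p.2| < k / h * p.1]).
    apply: measurableI; first (apply: measurableI;
      [apply: measurable_set_ler|apply: measurable_set_ltr]; solve_mfun).
    apply: (measurable_set_ltr (f := fun p : P => `|p.2|)); last solve_mfun.
    by apply: measurableT_comp => //; solve_mfun.
  by apply/seteqP; split => p /=; [case=> /andP[]|case=> -[a b] c; split=> //; apply/andP].
have CTS : cap0 h `|` Tr `<=` S.
  rewrite subUset; split; first by apply: cap0_sub_sector0; lra.
  move=> [a b] /= [/andP[a0 ah] bk].
  have a1 : 0 < a.
    rewrite lt_neqAle a0 andbT; apply/eqP => a00; move: bk; rewrite -a00 mulr0.
    by rewrite normr_lt0.
  have : b ^+ 2 * h ^+ 2 < k ^+ 2 * a ^+ 2.
    rewrite -!exprMn -(real_normK (num_real (b * h))) ltr_pXn2r ?nnegrE //; last nra.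
    rewrite normrM (ger0_norm (_ : 0 <= h)); last by lra.
    by rewrite -ltr_pdivlMr; [rewrite mulrAC|lra].
  move=> bh.
  have ab : h ^+ 2 * (a ^+ 2 + b ^+ 2) < 4 / 3 * a ^+ 2 by rewrite -hk2; lra.
  split => //=.
  have : a ^+ 2 < h ^+ 2 by rewrite ltr_pXn2r ?nnegrE //; lra.
  have : 0 < h ^+ 2 by rewrite exprn_gt0 //; lra.
  nra.
have CT0 : cap0 h `&` Tr = set0.
  by apply/seteqP; split => -[a b] // [/= [/= ha _] [/= /andP[_ ah] _]]; lra.
(* A lower bound for the sector suffices: the cap and the triangle are disjoint in it and have total
   area T^2 x. *)
have : (area (cap0 h) + area Tr <= area S)%E.
  rewrite -measureU //; last exact: measurable_cap0.
  apply: le_measure => //; rewrite inE.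
    by apply: measurableU => //; exact: measurable_cap0.
  exact: measurable_sector0.
rewrite aT aC -EFinD => aS.
have := @sin_cos_chord R x; rewrite -/kappa => chord.
have {}chord := chord ltac:(lra).
have k1 : 0 <= 1 - kappa by rewrite subr_ge0 kappa_le1.
apply: le_trans (lee_wpmul2l _ aS); last by rewrite lee_fin.
rewrite -EFinM lee_fin hk /k T2.
have -> : T * cos x * (T * sin x) = T ^+ 2 * (sin x * cos x) by ring.
rewrite T2; nra.
Qed.
End cap_in_sector.

(** * Truncated Voronoi cells of separated centers *)

Section truncated_cells.
Context {R : realType}.
Local Notation M := (measurableTypeR R).
Local Notation P := (M * M)%type.
Local Notation dist := (@Defs.edist R).
Implicit Types (c p : R * R) (F : set (R * R)).

(** Polynomial in the coordinates, unlike the distance, hence within reach of [ring], [lra] and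
    [nra]. *)
Definition sqdist (p q : R * R) : R := (p.1 - q.1) ^+ 2 + (p.2 - q.2) ^+ 2.

Lemma sqdist_ge0 p q : 0 <= sqdist p q.
Proof. by rewrite addr_ge0 ?sqr_ge0. Qed.

Lemma dist_ge0 p q : 0 <= dist p q. Proof. exact: sqrtr_ge0. Qed.

Lemma sqr_dist p q : dist p q ^+ 2 = sqdist p q.
Proof. by rewrite sqr_sqrtr // sqdist_ge0. Qed.

Lemma distC p q : dist p q = dist q p.
Proof. by rewrite /Defs.edist; congr Num.sqrt; ring. Qed.

Lemma dist_le p q (r : R) : 0 <= r -> (dist p q <= r) = (sqdist p q <= r ^+ 2).
Proof. by move=> r0; rewrite -sqr_dist ler_pXn2r ?nnegrE ?dist_ge0. Qed.

Lemma dist_lt p q (r : R) : 0 <= r -> (dist p q < r) = (sqdist p q < r ^+ 2).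
Proof. by move=> r0; rewrite -sqr_dist ltr_pXn2r ?nnegrE ?dist_ge0. Qed.

Lemma dist_triangle p q s : dist p s <= dist p q + dist q s.
Proof.
rewrite dist_le ?addr_ge0 ?dist_ge0 //.
have a0 := dist_ge0 p q; have b0 := dist_ge0 q s.
rewrite sqrrD !sqr_dist; set a := dist p q in a0 *; set b := dist q s in b0 *.
pose x := (p.1 - q.1) * (q.1 - s.1) + (p.2 - q.2) * (q.2 - s.2).
have -> : sqdist p s = sqdist p q + 2 * x + sqdist q s by rewrite /sqdist /x; ring.
suff : x <= a * b by rewrite -mulr_natl; lra.
apply: le_trans (ler_norm x) _.
rewrite -(@ler_pXn2r _ 2) // ?nnegrE ?mulr_ge0 //.
rewrite real_normK ?num_real // exprMn !sqr_dist /sqdist /x.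
(* Lagrange's identity: the defect in the Cauchy-Schwarz inequality is the square of a cross
   product. *)
rewrite -subr_ge0 (_ : _ - _ =
  ((p.1 - q.1) * (q.2 - s.2) - (p.2 - q.2) * (q.1 - s.1)) ^+ 2) ?sqr_ge0 //.
ring.
Qed.

Definition unit_separated F := forall c c', F c -> F c' -> c != c' -> 2 <= dist c c'.

Definition direction c c' : R * R :=
  ((c'.1 - c.1) / dist c c', (c'.2 - c.2) / dist c c').

Lemma direction_unit c c' : 0 < dist c c' ->
  (direction c c').1 ^+ 2 + (direction c c').2 ^+ 2 = 1.
Proof.
move=> d0; rewrite /= !exprMn -mulrDl exprVn sqr_dist.
have : sqdist c c' != 0 by rewrite -sqr_dist expf_neq0 // gt_eqF.
move=> s0; rewrite -[RHS](divff s0); congr (_ / _); rewrite /sqdist; ring.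
Qed.

Lemma frame_norm c u p : u.1 ^+ 2 + u.2 ^+ 2 = 1 ->
  (frame c u p).1 ^+ 2 + (frame c u p).2 ^+ 2 = sqdist c p.
Proof.
move=> u1; rewrite -[RHS]mulr1 -u1 /frame /sqdist /=; ring.
Qed.

(** The law of cosines. It shows that the points nearer to [c'] than to [c] are those whose first
    frame coordinate exceeds half of [dist c c']. *)
Lemma frame_direction c c' p : 0 < dist c c' ->
  sqdist c' p = sqdist c p - 2 * dist c c' * (frame c (direction c c') p).1
                + dist c c' ^+ 2.
Proof.
move=> d0; rewrite /frame /direction /=.
have -> : 2 * dist c c' * ((p.1 - c.1) * ((c'.1 - c.1) / dist c c') +
   (p.2 - c.2) * ((c'.2 - c.2) / dist c c')) =
   2 * ((p.1 - c.1) * (c'.1 - c.1) + (p.2 - c.2) * (c'.2 - c.2)).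
  by field; rewrite gt_eqF.
by rewrite sqr_dist /sqdist; ring.
Qed.

(* The squared distances between the three points sum to at most three times
   the sum of their squared distances to [w]. *)
Lemma three_points (w c1 c2 c3 : R * R) :
  sqdist c1 w <= 4 / 3 -> sqdist c2 w < 4 / 3 -> sqdist c3 w < 4 / 3 ->
  2 <= dist c1 c2 -> 2 <= dist c1 c3 -> 2 <= dist c2 c3 -> False.
Proof.
have e4 p q : 2 <= dist p q -> 4 <= sqdist p q.
  by move=> ?; rewrite -sqr_dist; nra.
move=> w1 w2 w3 /e4 c12 /e4 c13 /e4 c23.
have := sqr_ge0 (c1.1 + c2.1 + c3.1 - 3 * w.1).
have := sqr_ge0 (c1.2 + c2.2 + c3.2 - 3 * w.2).
have : sqdist c1 c2 + sqdist c1 c3 + sqdist c2 c3 =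
  3 * (sqdist c1 w + sqdist c2 w + sqdist c3 w) -
  (c1.1 + c2.1 + c3.1 - 3 * w.1) ^+ 2 - (c1.2 + c2.2 + c3.2 - 3 * w.2) ^+ 2.
  by rewrite /sqdist; ring.
lra.
Qed.

(* [cap c c'] is the part nearer to [c'] than to [c] of the disc of radius
   [2 / sqrt 3] about [c]; [sector c c'] is the sector of that disc it spans. *)
Definition sector c c' : set P :=
  (frame c (direction c c') : P -> P) @^-1` sector0 (dist c c' / 2).

Definition cap c c' : set P :=
  (frame c (direction c c') : P -> P) @^-1` cap0 (dist c c' / 2).

Lemma sectorE c c' p : sector c c' p = [/\ 0 < (frame c (direction c c') p).1,
  (dist c c' / 2) ^+ 2 * ((frame c (direction c c') p).1 ^+ 2 + (frame c (direction c c') p).2 ^+ 2)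
    < 4 / 3 * (frame c (direction c c') p).1 ^+ 2 &
  (frame c (direction c c') p).1 ^+ 2 + (frame c (direction c c') p).2 ^+ 2 < 4 / 3].
Proof. by []. Qed.

Lemma capE c c' p : cap c c' p = (dist c c' / 2 <= (frame c (direction c c') p).1 /\
  (frame c (direction c c') p).1 ^+ 2 + (frame c (direction c c') p).2 ^+ 2 < 4 / 3).
Proof. by []. Qed.

(* A common point of two sectors can be pushed radially from [c] to distance
   [2 / sqrt 3], where it becomes closer to both [c1] and [c2] than to [c]. *)
Lemma sector_disjoint c c1 c2 p : 2 <= dist c c1 -> 2 <= dist c c2 ->
  2 <= dist c1 c2 -> sector c c1 p -> sector c c2 p -> False.
Proof.
move=> d1 d2 d12.
have dp1 : 0 < dist c c1 by lra.
have dp2 : 0 < dist c c2 by lra.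
rewrite !sectorE !(frame_norm c p (direction_unit dp1)) !(frame_norm c p (direction_unit dp2)).
set n := sqdist c p.
set x1 := (frame c (direction c c1) p).1; set x2 := (frame c (direction c c2) p).1.
move=> [x10 s1 nT] [x20 s2 _].
have n0 : 0 < n.
  rewrite /n -(frame_norm c p (direction_unit dp1)) -/x1.
  by rewrite ltr_pwDl ?sqr_ge0 // exprn_gt0.
pose s := Num.sqrt (4 / 3 / n).
have s0 : 0 < s by rewrite sqrtr_gt0 divr_gt0 //; lra.
have sn : s ^+ 2 * n = 4 / 3.
  by rewrite sqr_sqrtr; [rewrite divfK // gt_eqF|rewrite divr_ge0 ?ltW //; lra].
pose w : R * R := (c.1 + s * (p.1 - c.1), c.2 + s * (p.2 - c.2)).
have frw u : (frame c u w).1 = s * (frame c u p).1 by rewrite /w /frame /=; ring.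
have cw : sqdist c w = 4 / 3 by rewrite -sn /n /sqdist /w /=; ring.
have close c' x : 0 < x -> 0 < dist c c' -> x = (frame c (direction c c') p).1 ->
    (dist c c' / 2) ^+ 2 * n < 4 / 3 * x ^+ 2 -> sqdist c' w < 4 / 3.
  move=> x0 d0 xE h.
  rewrite (frame_direction w d0) cw frw -xE; set d := dist c c' in d0 h *.
  have : (d / 2) ^+ 2 < (s * x) ^+ 2.
    rewrite -(ltr_pM2r n0) (_ : (s * x) ^+ 2 * n = s ^+ 2 * n * x ^+ 2).
      by rewrite sn.
    by ring.
  have d20 : 0 <= d / 2 by lra.
  have sx0 : 0 <= s * x by rewrite mulr_ge0 // ltW.
  rewrite ltr_pXn2r ?nnegrE //; move: (s * x) => y; nra.
apply: (@three_points w c c1 c2) => //; first by rewrite cw.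
- exact: (close _ x1).
- exact: (close _ x2).
Qed.

Definition truncated_cell F c : set P :=
  [set p | sqdist c p < 4 / 3] `\` \bigcup_(c' in F `\ c) cap c c'.

Lemma measurable_open_disc c (r : R) : measurable [set p : P | sqdist c p < r].
Proof. by apply: measurable_set_ltr; rewrite /sqdist; solve_mfun. Qed.

Lemma measurable_caps F c : finite_set F ->
  measurable (\bigcup_(c' in F `\ c) cap c c').
Proof.
move=> finF; apply: fin_bigcup_measurable; first exact: finite_setD.
by move=> c' _; apply: measurable_frame_preimage; exact: measurable_cap0.
Qed.

Lemma measurable_truncated_cell F c : finite_set F ->
  measurable (truncated_cell F c).
Proof.
move=> finF; apply: measurableD; first exact: measurable_open_disc.
exact: measurable_caps.
Qed.

Lemma trivIset_truncated_cell F : unit_separated F -> trivIset F (truncated_cell F).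
Proof.
move=> sF.
(* A point common to two cells lies in a cap removed from the cell of whichever center is not nearer
   to it. *)
have aux c c' p : F c -> F c' -> c != c' -> truncated_cell F c p ->
    truncated_cell F c' p -> sqdist c p <= sqdist c' p -> False.
  move=> Fc Fc' cc' _ [/= c'p capsN] le.
  apply: capsN; exists c; first by split => //=; apply/eqP.
  have d2 : 2 <= dist c' c by rewrite distC; exact: sF.
  have d0 : 0 < dist c' c by lra.
  rewrite capE; split.
    move: le; rewrite (frame_direction p d0); move: (frame _ _ p).1 => x; nra.
  by rewrite frame_norm //; exact: direction_unit.
move=> c c' Fc Fc' [p [cp c'p]]; apply/eqP; apply: contraT => cc'.
have [le|/ltW le] := leP (sqdist c p) (sqdist c' p).
  by case: (aux c c' p).
by case: (aux c' c p) => //; rewrite eq_sym.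
Qed.

Lemma area_open_disc c (r : R) : 0 < r ->
  area ([set p | sqdist c p < r ^+ 2] : set P) = (pi * r ^+ 2)%:E.
Proof.
move=> r0; rewrite -(area_disc_lteif false r0) -[RHS](@area_frame _ c (1, 0)) /=; last 2 first.
- by ring.
- by apply: measurable_set_ltr; solve_mfun.
congr area; apply/seteqP; split => p;
  rewrite /preimage /mkset frame_norm //=; ring.
Qed.

Lemma area_truncated_cell F c : finite_set F -> unit_separated F -> F c ->
  ((Num.sqrt 12)%:E <= area (truncated_cell F c))%E.
Proof.
move=> finF sF Fc.
have dF c' : (F `\ c) c' -> 2 <= dist c c'.
  by move=> [Fc' /= c'c]; apply: sF => //; apply/eqP => /esym.
have finFc : finite_set (F `\ c) by exact: finite_setD.
have T0 : 0 < Num.sqrt (4 / 3) :> R by rewrite sqrtr_gt0; lra.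
have T2 : Num.sqrt (4 / 3) ^+ 2 = 4 / 3 :> R by rewrite sqr_sqrtr //; lra.
have WE : area [set p : P | sqdist c p < 4 / 3] = (pi * (4 / 3))%:E.
  by rewrite -T2 area_open_disc.
have msec c' : measurable (sector c c').
  by apply: measurable_frame_preimage; exact: measurable_sector0.
(* The sectors are pairwise disjoint and lie in the disc of squared radius 4 / 3. *)
have sectors_le : (\sum_(c' \in F `\ c) area (sector c c') <= (pi * (4 / 3))%:E)%E.
  rewrite -measure_fin_bigcup //; last first.
    move=> c1 c2 Fc1 Fc2 [p [s1 s2]]; apply/eqP; apply: contraT => c12.
    case: (@sector_disjoint c c1 c2 p) => //; try exact: dF.
    by apply: sF => //; [case: Fc1|case: Fc2].
  rewrite -WE; apply: le_measure; rewrite ?inE //.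
  - exact: fin_bigcup_measurable.
  - exact: measurable_open_disc.
  move=> p [c' /dF d2]; rewrite sectorE => -[_ _]; rewrite frame_norm //.
  by apply: direction_unit; lra.
have caps_le : (area (\bigcup_(c' in F `\ c) cap c c') <=
    ((1 - kappa) * (pi * (4 / 3)))%:E)%E.
  apply: (le_trans (content_sub_fsum _ finFc _ _ (@subset_refl _ _))).
  - by move=> c' _; apply: measurable_frame_preimage; exact: measurable_cap0.
  - exact: measurable_caps.
  have k1 : (0 <= (1 - kappa : R)%:E)%E by rewrite lee_fin subr_ge0 kappa_le1.
  rewrite EFinM; apply: le_trans (lee_wpmul2l k1 sectors_le).
  rewrite ge0_mule_fsumr; last by move=> c'; exact: measure_ge0.
  apply: lee_fsum => // c' /dF d2.
  have u1 : (direction c c').1 ^+ 2 + (direction c c').2 ^+ 2 = 1.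
    by apply: direction_unit; lra.
  change (area (cap c c') <= (1 - kappa)%:E * area (sector c c'))%E.
  rewrite [area (cap _ _)]area_frame //; last exact: measurable_cap0.
  rewrite [area (sector _ _)]area_frame //; last exact: measurable_sector0.
  by apply: area_cap0_le; lra.
rewrite /truncated_cell [area _]measureD; last 3 first.
- exact: measurable_open_disc.
- exact: measurable_caps.
- by rewrite [X in (X < _)%E]WE ltry.
rewrite [X in (_ <= X - _)%E]WE.
(* What remains is kappa * pi * 4 / 3 = 2 sqrt 3 = sqrt 12. *)
apply: (@le_trans _ _ ((pi * (4 / 3))%:E - ((1 - kappa) * (pi * (4 / 3)))%:E)%E).
  rewrite -EFinB lee_fin.
  have -> : Num.sqrt 12 = 2 * Num.sqrt 3 :> R.
    rewrite (_ : 12 = 2 ^+ 2 * 3); last by ring.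
    by rewrite sqrtrM ?sqr_ge0 // sqrtr_sqr ger0_norm.
  have pn0 : pi != 0 :> R by rewrite gt_eqF // pi_gt0.
  rewrite /kappa le_eqVlt; apply/orP; left; apply/eqP.
  by move: pn0; generalize (pi : R) => q q0; field.
apply: leeB => //; apply: le_trans caps_le; apply: le_measure; rewrite ?inE.
- apply: measurableI; first exact: measurable_open_disc.
  exact: measurable_caps.
- exact: measurable_caps.
- exact: subIsetr.
Qed.
End truncated_cells.

(** * Counting the centers of a packing in a large disc *)

Section packing_bound.
Context {R : realType}.
Local Notation M := (measurableTypeR R).
Local Notation P := (M * M)%type.
Local Notation dist := (@Defs.edist R).
Implicit Types (c p : R * R) (F C : set (R * R)).

Lemma dist_lt_interior c p (r : R) : dist c p < r -> (interior (disc c r)) p.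
Proof.
(* Balls here are sup-norm squares; halving the gap makes the square fit in the Euclidean disc, as
   sqrt 2 <= 2. *)
move=> cp; apply/nbhs_ballP; exists ((r - dist c p) / 2) => /=.
  by rewrite divr_gt0 // subr_gt0.
move=> q [/= pq1 pq2]; rewrite /disc /=; apply: le_trans (dist_triangle c p q) _.
rewrite -lerBrDl dist_le; last by lra.
move: pq1 pq2; rewrite /ball /= /sqdist; set e := _ - _.
move=> pq1 pq2.
rewrite -(real_normK (num_real (p.1 - q.1))) -(real_normK (num_real (p.2 - q.2))).
have := normr_ge0 (p.1 - q.1); have := normr_ge0 (p.2 - q.2).
move: `|p.1 - q.1| `|p.2 - q.2| pq1 pq2 => x y; nra.
Qed.

(** If two centers were at distance less than 2, their midpoint would be interior to both discs. *)
Lemma packing_unit_separated C : unit_circle_packing C -> unit_separated C.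
Proof.
move=> pC c c' Cc Cc' cc'; rewrite leNgt; apply/negP => d2.
pose m : R * R := ((c.1 + c'.1) / 2, (c.2 + c'.2) / 2).
have half q : (q = c \/ q = c') -> dist q m < 1.
  move=> qE; rewrite dist_lt // expr1n.
  have -> : sqdist q m = sqdist c c' / 4.
    by case: qE => ->; rewrite /sqdist /m /=; field.
  by rewrite -sqr_dist; have := dist_ge0 c c'; nra.
move/eqP: cc'; apply; apply: pC => //; exists m; split;
  apply: dist_lt_interior; apply: half; by [left|right].
Qed.

Lemma in_disc c p (r : R) : 0 <= r -> (disc c r p) = (sqdist c p <= r ^+ 2).
Proof. by move=> r0; rewrite /disc /= dist_le. Qed.

Lemma area_disc c (r : R) : 0 < r -> area (disc c r) = (pi * r ^+ 2)%:E.
Proof.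
move=> r0; rewrite -(area_disc_lteif true r0) -[RHS](@area_frame _ c (1, 0)) /=; last 2 first.
- by ring.
- by apply: measurable_set_ler; solve_mfun.
congr area; apply/seteqP; split => p;
  rewrite in_disc ?(ltW r0) // /preimage /mkset frame_norm //=; ring.
Qed.

Lemma measurable_disc c (r : R) : 0 <= r -> measurable (disc c r : set P).
Proof.
move=> r0; rewrite (_ : disc c r = [set p : P | sqdist c p <= r ^+ 2]).
  by apply: measurable_set_ler; rewrite /sqdist; solve_mfun.
by apply/seteqP; split => p; rewrite in_disc.
Qed.

(** For finite [F] the sum of ones is its cardinality as a real number, the form in which centers
    are counted below. *)
Lemma fsum_const (F : set (R * R)) (a : R) :
  \sum_(c \in F) a = a * \sum_(c \in F) (1 : R).
Proof. by rewrite mulr_fsumr; apply: eq_fsbigr => c _; rewrite mulr1. Qed.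

(** The cells are disjoint, have area at least sqrt 12 and, as T < 2, lie in the disc of radius
    [s + 2]. *)
Lemma unit_separated_card_le F (s : R) : finite_set F -> unit_separated F -> 0 <= s ->
  F `<=` disc (0, 0) s ->
  Num.sqrt 12 * \sum_(c \in F) (1 : R) <= pi * (s + 2) ^+ 2.
Proof.
move=> finF sF s0 Fs; rewrite -fsum_const -lee_fin -fsumEFin //.
have s2 : 0 < s + 2 by lra.
rewrite -(area_open_disc (0, 0) s2).
apply: (@le_trans _ _ (\sum_(c \in F) area (truncated_cell F c))%E).
  by apply: lee_fsum => // c Fc; exact: area_truncated_cell.
rewrite -measure_fin_bigcup //.
- apply: le_measure; rewrite ?inE.
  + by apply: fin_bigcup_measurable => // c _; exact: measurable_truncated_cell.
  + exact: measurable_open_disc.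
  move=> p [c Fc [/= cp _]]; rewrite /mkset -dist_lt; last exact: ltW.
  apply: le_lt_trans (dist_triangle _ c _) _; apply: ler_ltD; first exact: Fs.
  by rewrite dist_lt //; lra.
- exact: trivIset_truncated_cell.
- by move=> c _; exact: measurable_truncated_cell.
Qed.

Lemma sub_unit_separated F C : F `<=` C -> unit_separated C -> unit_separated F.
Proof. by move=> FC sC c c' /FC Cc /FC Cc'; exact: sC. Qed.

Lemma finite_unit_separated C (s : R) : unit_separated C -> 0 <= s ->
  finite_set (C `&` disc (0, 0) s).
Proof.
move=> sC s0; apply: contrapT.
(* An infinite set would contain [n] centers, more than the counting bound allows, because sqrt 12
   >= 1. *)
pose n := (Num.truncn (pi * (s + 2) ^+ 2)).+1.
move=> /(@infinite_set_fset _ _ n) [B BC Bn].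
have BCC : [set` B] `<=` C by move=> c /BC[].
have := @unit_separated_card_le [set` B] s (finite_fset B) (sub_unit_separated BCC sC) s0.
have Bs : [set` B] `<=` disc (0, 0) s by move=> c /BC[].
move=> /(_ Bs).
rewrite fsbig_finite // set_fsetK /= big_const_seq count_predT iter_addr_0.
apply/negP; rewrite -ltNge.
apply: (@lt_le_trans _ _ n%:R).
  by rewrite /n truncnS_gt.
apply: (@le_trans _ _ (size (finmap.enum_fset B))%:R); first by rewrite ler_nat.
have : 1 <= Num.sqrt 12 :> R by rewrite -[X in X <= _]sqrtr1 ler_sqrt //; lra.
have : 0 <= (size (finmap.enum_fset B))%:R :> R by [].
nra.
Qed.

(** A unit disc meeting the disc of radius [r] has its center within [r + 1] of the origin; for
    separated centers the union becomes finite. *)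
Lemma covered_disc C (r : R) : 0 < r -> covered C `&` disc (0, 0) r =
  (\bigcup_(c in C `&` disc (0, 0) (r + 1)) disc c 1) `&` disc (0, 0) r.
Proof.
move=> r0; apply/seteqP; split => p [[c Cc cp] pr]; split => //; last first.
  by exists c => //; case: Cc.
exists c => //; split => //; rewrite /disc /=.
apply: le_trans (dist_triangle _ p _) _; apply: lerD => //.
by rewrite distC.
Qed.

Lemma measurable_covered_disc C (r : R) : unit_separated C -> 0 < r ->
  measurable (covered C `&` disc (0, 0) r : set P).
Proof.
move=> sC r0; rewrite covered_disc //.
apply: measurableI; last by apply: measurable_disc; exact: ltW.
apply: fin_bigcup_measurable; first by apply: finite_unit_separated => //; lra.
by move=> c _; apply: measurable_disc.
Qed.

Lemma area_covered_le C (r : R) : unit_separated C -> 0 < r ->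
  (area (covered C `&` disc (0, 0)%R r) <=
   (pi / Num.sqrt 12 * (pi * (r + 3) ^+ 2))%:E)%E.
Proof.
move=> sC r0.
have r1 : 0 <= r + 1 by lra.
set F := C `&` disc (0, 0) (r + 1).
have finF : finite_set F by exact: finite_unit_separated.
have s0 : 0 < Num.sqrt 12 :> R by rewrite sqrtr_gt0.
have p0 := pi_gt0 R.
apply: (@le_trans _ _ (\sum_(c \in F) pi%:E)%E).
  apply: (le_trans (content_sub_fsum (A_ := fun c => disc c 1 : set P) _ finF _ _ _)).
  - by move=> c _; exact: measurable_disc.
  - exact: measurable_covered_disc.
  - by rewrite covered_disc //; exact: subIsetl.
  apply: lee_fsum => // c _; change (area (disc c 1) <= pi%:E)%E.
  by rewrite area_disc // expr1n mulr1.
rewrite fsumEFin // lee_fin fsum_const.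
have := @unit_separated_card_le F (r + 1) finF (sub_unit_separated (@subIsetl _ _ _) sC) r1
  (@subIsetr _ _ _).
(* The 1 accounts for centers outside the disc of radius [r], the 2 for their cells. *)
rewrite (_ : r + 1 + 2 = r + 3); last by ring.
move: (\sum_(c \in F) (1 : R)) => n nle.
by rewrite -[X in _ <= X]mulrA ler_pM2l // ler_pdivlMl //.
Qed.

End packing_bound.

(** * Bounds for an upper limit at infinity *)

Section limsup.
Context {R : realType}.

Lemma limf_esup_pinfty_le (f : R -> R) (l : R) :
  (forall e, 0 < e -> exists m, forall r, m < r -> f r <= l + e) ->
  (limf_esup (fun r => (f r)%:E) (pinfty_nbhs R) <= l%:E)%E.
Proof.
move=> fl; apply/lee_addgt0Pr => e e0; have [m fm] := fl e e0.
rewrite limf_esupE; apply: (@le_trans _ _ (ereal_sup [set (f r)%:E | r in [set r | m < r]])).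
  apply: ereal_inf_lbound; exists [set r | m < r] => //.
  by exists m; split => //; exact: num_real.
by apply: ge_ereal_sup => _ [r mr <-]; rewrite -EFinD lee_fin; exact: fm.
Qed.

Lemma limf_esup_pinfty_ge (f : R -> R) (l : R) :
  (forall e, 0 < e -> exists m, forall r, m < r -> l - e <= f r) ->
  (l%:E <= limf_esup (fun r => (f r)%:E) (pinfty_nbhs R))%E.
Proof.
move=> fl; rewrite limf_esupE; apply: le_ereal_inf_tmp => _ [V [m [_ mV]] <-].
apply/lee_addgt0Pr => e e0; have [m' fm] := fl e e0.
(* A point beyond both thresholds: it lies in the neighborhood [V] and satisfies the lower bound on
   [f]. *)
pose r := Num.max m m' + 1.
have mr : m < r by rewrite ltr_pwDr // le_max lexx.
have mr' : m' < r by rewrite ltr_pwDr // le_max lexx orbT.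
rewrite -leeBlDr // -EFinB.
apply: (@le_trans _ _ (f r)%:E); first by rewrite lee_fin; exact: fm.
by apply: ereal_sup_ubound; exists r => //; exact: mV.
Qed.
End limsup.

(** * Hexagonal tilings: density from below, and the lattice tiling *)

Section hexagons.
Context {R : realType}.
Local Notation M := (measurableTypeR R).
Local Notation P := (M * M)%type.
Local Notation dist := (@Defs.edist R).
Implicit Types (c p : R * R) (C : set (R * R)).

(** The index is a natural number, so that [k + 3] can name the side opposite to side [k]. *)
Definition hexagon_form c (t : R) (k : nat) p : R :=
  (p.1 - c.1) * cos (t + k%:R * (pi / 3)) +
  (p.2 - c.2) * sin (t + k%:R * (pi / 3)).

Lemma hexagon_formE c t k p : hexagon_form c t k p =
  (frame c (cos t, sin t) p).1 * cos (k%:R * (pi / 3)) +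
  (frame c (cos t, sin t) p).2 * sin (k%:R * (pi / 3)).
Proof. by rewrite /hexagon_form cosD sinD /frame /=; ring. Qed.

Lemma hexagon_form_opp c t k p :
  hexagon_form c t (k + 3) p = - hexagon_form c t k p.
Proof.
rewrite /hexagon_form natrD.
have -> : t + (k%:R + 3) * (pi / 3) = (t + k%:R * (pi / 3)) + pi by field.
by rewrite cosDpi sinDpi; ring.
Qed.

Lemma hexagon_forms c t p (q := frame c (cos t, sin t) p) :
  [/\ hexagon_form c t 0 p = q.1,
      hexagon_form c t 1 p = (q.1 + Num.sqrt 3 * q.2) / 2 &
      hexagon_form c t 2 p = - ((q.1 - Num.sqrt 3 * q.2) / 2)].
Proof.
rewrite !hexagon_formE -/q mul0r mul1r cos0 sin0 cos_pi3 sin_pi3; split.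
- by ring.
- by field.
have -> : 2 * (pi / 3) = - (pi / 3) + pi :> R by field.
by rewrite cosDpi sinDpi cosN sinN cos_pi3 sin_pi3; field.
Qed.

Lemma hexagonE c t p :
  hexagon c t p <-> hexagon0 (frame c (cos t, sin t) p).
Proof.
have [f0 f1 f2] := hexagon_forms c t p.
have f3 := hexagon_form_opp c t 0 p; have f4 := hexagon_form_opp c t 1 p.
have f5 := hexagon_form_opp c t 2 p.
rewrite /hexagon0 /mkset; move: f0 f1 f2; move: (frame _ _ p) => q f0 f1 f2.
split=> [H|[]].
  have H' k : (k < 6)%N -> hexagon_form c t k p <= 1.
    by move=> k6; exact: (H (Ordinal k6)).
  have := H' 0%N isT; have := H' 1%N isT; have := H' 2%N isT.
  have := H' 3%N isT; have := H' 4%N isT; have := H' 5%N isT.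
  rewrite f3 f4 f5 f0 f1 f2 => h5 h4 h3 h2 h1 h0.
  by split; rewrite ler_norml; apply/andP; split; lra.
rewrite !ler_norml => /andP[x1 x2] /andP[x3 x4] /andP[x5 x6].
case=> -[|[|[|[|[|[|k]]]]]] // k6; rewrite -/(hexagon_form c t _ p) /=.
- by rewrite f0; lra.
- by rewrite f1; lra.
- by rewrite f2; lra.
- by rewrite f3 f0; lra.
- by rewrite f4 f1; lra.
- by rewrite f5 f2; lra.
Qed.

Lemma cos_sin_unit (t : R) : (cos t, sin t).1 ^+ 2 + (cos t, sin t).2 ^+ 2 = 1 :> R.
Proof. exact: cos2Dsin2. Qed.

Lemma hexagon_frame c t :
  hexagon c t = (frame c (cos t, sin t) : P -> P) @^-1` hexagon0.
Proof. by apply/seteqP; split => p; rewrite hexagonE. Qed.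

Lemma measurable_hexagon c t : measurable (hexagon c t : set P).
Proof.
by rewrite hexagon_frame; apply: measurable_frame_preimage; exact: measurable_hexagon0.
Qed.

Lemma area_hexagon_le c t : (area (hexagon c t) <= (Num.sqrt 12)%:E)%E.
Proof.
rewrite hexagon_frame area_frame; first exact: area_hexagon0.
  exact: cos_sin_unit.
exact: measurable_hexagon0.
Qed.

(** For a unit normal (a, b), expanding (x - a)^2 + (y - b)^2 >= 0 bounds a x + b y by (x^2 + y^2 +
    1) / 2 <= 1. *)
Lemma disc_sub_hexagon c t : disc c 1 `<=` hexagon c t.
Proof.
move=> p; rewrite in_disc // expr1n => cp k.
have := cos2Dsin2 (t + k%:R * (pi / 3)); move: (cos _) (sin _) => a b ab.
have := sqr_ge0 (p.1 - c.1 - a); have := sqr_ge0 (p.2 - c.2 - b).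
by move: cp; rewrite /sqdist; lra.
Qed.

Lemma dist_hexagon_le c t p : hexagon c t p -> dist c p <= 2.
Proof.
move/hexagonE; rewrite dist_le // -(frame_norm _ _ (cos_sin_unit t)).
move: (frame _ _ p) => -[x y] [/=].
have s3 : Num.sqrt 3 ^+ 2 = 3 :> R by rewrite sqr_sqrtr.
rewrite !ler_norml => /andP[x1 x2] /andP[x3 x4] /andP[x5 x6].
have : (Num.sqrt 3 * y) ^+ 2 <= 4 by set z := _ * _ in x3 x4 x5 x6 *; nra.
have : x ^+ 2 <= 1 by nra.
by rewrite exprMn s3; lra.
Qed.

Lemma regular_hexagon_packing_is_packing C :
  regular_hexagon_packing C -> unit_circle_packing C.
Proof.
move=> [t [_ tC]] c c' Cc Cc' [p [cp c'p]].
apply: (tC c c' Cc Cc'); exists p; split; [move: cp|move: c'p];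
  apply: interiorS; exact: disc_sub_hexagon.
Qed.

(** Tiles have radius at most 2, so those centered within [r - 1] cover the disc of radius [r - 3],
    which bounds their number below; their unit discs lie in the disc of radius [r]. *)
Lemma area_covered_ge C (t : R * R -> R) (r : R) : unit_separated C ->
  \bigcup_(c in C) hexagon c (t c) = setT -> 3 < r ->
  ((pi / Num.sqrt 12 * (pi * (r - 3) ^+ 2))%:E <=
   area (covered C `&` disc (0, 0)%R r))%E.
Proof.
move=> sC Ct r3; have r0 : 0 < r by lra.
have r1 : 0 <= r - 1 by lra.
have r30 : 0 < r - 3 by lra.
set F := C `&` disc (0, 0) (r - 1).
have finF : finite_set F by exact: finite_unit_separated.
have s0 : 0 < Num.sqrt 12 :> R by rewrite sqrtr_gt0.
have p0 := pi_gt0 R.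
have nge : pi * (r - 3) ^+ 2 <= Num.sqrt 12 * \sum_(c \in F) (1 : R).
  rewrite -fsum_const -lee_fin -(area_disc (0, 0) r30) -fsumEFin //.
  apply: (@le_trans _ _ (\sum_(c \in F) area (hexagon c (t c)))%E).
    apply: content_sub_fsum => //.
    - by move=> c _; exact: measurable_hexagon.
    - by apply: measurable_disc; exact: ltW.
    move=> p; rewrite /disc /= => pr.
    have : setT p by [].
    rewrite -Ct => -[c Cc cp]; exists c => //; split=> //; rewrite /disc /=.
    apply: le_trans (dist_triangle _ p _) _.
    by have := dist_hexagon_le cp; rewrite distC; lra.
  by apply: lee_fsum => // c _; exact: area_hexagon_le.
apply: (@le_trans _ _ (\sum_(c \in F) (pi : R)%:E)%E).
  rewrite fsumEFin // lee_fin fsum_const -[X in X <= _]mulrA ler_pM2l //.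
  by rewrite ler_pdivrMl.
(* Open discs have the same area, and separation makes them disjoint outright. *)
pose D c : set P := [set p | sqdist c p < 1 ^+ 2].
apply: (@le_trans _ _ (\sum_(c \in F) area (D c))%E).
  apply: lee_fsum => // c _; change (pi%:E <= area (D c))%E.
  by rewrite area_open_disc // expr1n mulr1.
have mD c : measurable (D c) by exact: measurable_open_disc.
rewrite -measure_fin_bigcup //; last first.
  move=> c c' [Cc _] [Cc' _] [p [cp c'p]]; apply/eqP; apply: contraT => cc'.
  have := sC _ _ Cc Cc' cc'; rewrite leNgt => /negP[].
  apply: le_lt_trans (dist_triangle _ p _) _.
  move: cp c'p; rewrite /D /= -!dist_lt // => cp; rewrite [dist c' p]distC; lra.
apply: le_measure; rewrite ?inE.
- by apply: fin_bigcup_measurable.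
- exact: measurable_covered_disc.
move=> p [c [Cc cr]]; rewrite /D /= -dist_lt // => cp; split.
  by exists c => //; exact: ltW.
rewrite /disc /=; apply: le_trans (dist_triangle _ c _) _.
by move: cr; rewrite /disc /=; lra.
Qed.

Lemma interior_hexagon_form c t p (k : 'I_6) :
  (interior (hexagon c t)) p -> hexagon_form c t k p < 1.
Proof.
move/nbhs_ballP => [e /= e0 eH].
pose a := t + k%:R * (pi / 3).
(* Moving [p] along the outward normal of side [k] raises the form by [e / 2] while staying in the
   hexagon. *)
pose q : R * R := (p.1 + e / 2 * cos a, p.2 + e / 2 * sin a).
have : hexagon c t q.
  apply: eH; split; rewrite /ball /= opprD addNKr normrN normrM gtr0_norm ?divr_gt0 //.
    have : `|cos a| <= 1 by rewrite ler_norml cos_geN1 cos_le1.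
    by nra.
  have : `|sin a| <= 1 by rewrite ler_norml sin_geN1 sin_le1.
  by nra.
move=> /(_ k); rewrite -/a /q /hexagon_form -/a /=.
have := cos2Dsin2 a; move: (cos a) (sin a) => x y xy.
have -> : (p.1 + e / 2 * x - c.1) * x + (p.2 + e / 2 * y - c.2) * y =
  (p.1 - c.1) * x + (p.2 - c.2) * y + e / 2 * (x ^+ 2 + y ^+ 2) by ring.
by rewrite xy; lra.
Qed.

(** The triangular lattice generated by (2, 0) and (1, sqrt 3). *)
Definition hexagonal_lattice : set (R * R) :=
  [set c | exists m n : int, c = (2 * m%:~R + n%:~R, Num.sqrt 3 * n%:~R)].

Lemma hexagonal_lattice_packing : regular_hexagon_packing hexagonal_lattice.
Proof.
have s0 : 0 < Num.sqrt 3 :> R by rewrite sqrtr_gt0.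
have s3 : Num.sqrt 3 * Num.sqrt 3 = 3 :> R by rewrite -expr2 sqr_sqrtr.
have fr0 c p : frame c (cos 0, sin 0) p = (p.1 - c.1, p.2 - c.2).
  by rewrite cos0 sin0 /frame /=; congr pair; ring.
exists (fun=> 0); split.
  apply/seteqP; split => // p _.
  (* The point lies in a 2 by sqrt 3 rectangle whose lower corners and upper midpoint are lattice
     points; one of their three hexagons contains it. *)
  pose n := Num.floor (p.2 / Num.sqrt 3).
  pose m := Num.floor ((p.1 - n%:~R) / 2).
  have [n1 n2] : n%:~R <= p.2 / Num.sqrt 3 /\ p.2 / Num.sqrt 3 < n%:~R + 1.
    by split; [exact: floor_le_tmp|rewrite -intrD1; exact: floorD1_gt].
  have [m1 m2] : m%:~R <= (p.1 - n%:~R) / 2 /\ (p.1 - n%:~R) / 2 < m%:~R + 1.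
    by split; [exact: floor_le_tmp|rewrite -intrD1; exact: floorD1_gt].
  have p2E : p.2 = p.2 / Num.sqrt 3 * Num.sqrt 3 by rewrite divfK // gt_eqF.
  move: p2E n1 n2; move: (p.2 / Num.sqrt 3) => y p2E n1 n2.
  pose z := 3 * (y - n%:~R); pose a := p.1 - n%:~R - 2 * m%:~R.
  have hex (m' n' : int) : `|p.1 - (2 * m'%:~R + n'%:~R)| <= 1 ->
      `|p.1 - (2 * m'%:~R + n'%:~R) + 3 * (y - n'%:~R)| <= 2 ->
      `|p.1 - (2 * m'%:~R + n'%:~R) - 3 * (y - n'%:~R)| <= 2 ->
      (\bigcup_(c in hexagonal_lattice) hexagon c 0) p.
    move=> h1 h2 h3; exists (2 * m'%:~R + n'%:~R, Num.sqrt 3 * n'%:~R).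
      by exists m', n'.
    apply/hexagonE; rewrite fr0 /hexagon0 /=.
    have -> : Num.sqrt 3 * (p.2 - Num.sqrt 3 * n'%:~R) = 3 * (y - n'%:~R).
      by rewrite p2E -[X in _ = X * _]s3; ring.
    by split.
  have [z1|z1] := leP (1 + `|a - 1|) z.
    apply: (hex m (n + 1)); rewrite intrD; move: z1; rewrite /a /z;
      rewrite ler_norml; case: (ger0P (p.1 - n%:~R - 2 * m%:~R - 1)) => ? ?;
      apply/andP; split; lra.
  have [a1|a1] := leP a 1.
    apply: (hex m n); rewrite ler_norml; move: z1 a1; rewrite /a /z;
    case: (ger0P (p.1 - n%:~R - 2 * m%:~R - 1)) => ? ? ?; apply/andP; split; lra.
  apply: (hex (m + 1) n); rewrite intrD ler_norml; move: z1 a1; rewrite /a /z;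
    case: (ger0P (p.1 - n%:~R - 2 * m%:~R - 1)) => ? ? ?; apply/andP; split; lra.
move=> _ _ [m [n ->]] [m' [n' ->]] [p [pc pc']].
have forms c : (interior (hexagon c 0)) p ->
    [/\ `|p.1 - c.1| < 1, `|p.1 - c.1 + Num.sqrt 3 * (p.2 - c.2)| < 2 &
        `|p.1 - c.1 - Num.sqrt 3 * (p.2 - c.2)| < 2].
  move=> /interior_hexagon_form H.
  have H' k : (k < 6)%N -> hexagon_form c 0 k p < 1.
    by move=> k6; exact: (H (Ordinal k6)).
  have := H' 0%N isT; have := H' 1%N isT; have := H' 2%N isT.
  have := H' 3%N isT; have := H' 4%N isT; have := H' 5%N isT.
  rewrite (hexagon_form_opp c 0 0) (hexagon_form_opp c 0 1) (hexagon_form_opp c 0 2).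
  have [-> -> ->] := hexagon_forms c 0 p; rewrite fr0 /= => h5 h4 h3 h2 h1 h0.
  by split; rewrite ltr_norml; apply/andP; split; lra.
have := forms _ pc; have := forms _ pc'; rewrite /= !mulrBr !mulrA !s3.
set z := Num.sqrt 3 * p.2; rewrite !ltr_norml.
move=> [/andP[a1 a2] /andP[a3 a4] /andP[a5 a6]] [/andP[b1 b2] /andP[b3 b4] /andP[b5 b6]].
(* A common interior point forces 2 L + N, L + 2 N and L - N to be less than 2 in absolute value, so
   at most 1 as integers; combining them gives |3 L| <= 2 and |3 N| <= 2. *)
pose N := n - n'; pose L := m - m'.
have le1 (i : int) : i%:~R < 2 :> R -> i <= 1.
  by rewrite -[2]/(2%:~R) ltr_int -ltzD1.
have eq0 (i : int) : -1 < i -> i < 1 -> i = 0.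
  by move=> i1 i2; apply/le_anti/andP; split; [rewrite -ltzD1|rewrite -lezD1 in i1].
have i1 : 2 * L + N <= 1 by apply: le1; rewrite intrD intrM !intrB; lra.
have i2 : - (2 * L + N) <= 1 by apply: le1; rewrite intrN intrD intrM !intrB; lra.
have i3 : L + 2 * N <= 1 by apply: le1; rewrite intrD intrM !intrB; lra.
have i4 : - (L + 2 * N) <= 1 by apply: le1; rewrite intrN intrD intrM !intrB; lra.
have i5 : L - N <= 1 by apply: le1; rewrite intrB !intrB; lra.
have i6 : N - L <= 1 by apply: le1; rewrite intrB !intrB; lra.
have L0 : L = 0 by apply: eq0; lra.
have N0 : N = 0 by apply: eq0; lra.
by move/eqP: L0; rewrite subr_eq0 => /eqP ->; move/eqP: N0; rewrite subr_eq0 => /eqP ->.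
Qed.
End hexagons.

(** * Passage to the limit *)

Section density.
Context {R : realType}.
Implicit Types (C : set (R * R)).

Let hexd : R := pi / Num.sqrt 12.

Let hexd_gt0 : 0 < hexd.
Proof. by rewrite divr_gt0 ?pi_gt0 ?sqrtr_gt0. Qed.

Let area_covered_fin C (r : R) : unit_separated C -> 0 < r ->
  area (covered C `&` disc (0, 0) r) \is a fin_num.
Proof.
move=> sC r0; rewrite ge0_fin_numE ?measure_ge0 //.
exact: le_lt_trans (area_covered_le sC r0) (ltry _).
Qed.

Let disc_ratioE (r k : R) : 0 < r ->
  hexd * (pi * (r + k) ^+ 2) / (pi * r ^+ 2) = hexd + hexd * (2 * k / r + k ^+ 2 / r ^+ 2).
Proof.
have := pi_gt0 R; generalize (pi : R) => q q0 r0.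
by field; rewrite !gt_eqF.
Qed.

Lemma packing_density_le C : unit_separated C ->
  (packing_density C <= hexd%:E)%E.
Proof.
move=> sC; apply: limf_esup_pinfty_le => e e0.
(* For r > 1 the relative error 6 / r + 9 / r^2 is at most 15 / r. *)
exists (1 + 15 * hexd / e) => r re.
have d0 : 0 < 15 * hexd / e by rewrite divr_gt0 // mulr_gt0.
have r1 : 1 < r by lra.
have r0 : 0 < r by lra.
have A0 : 0 < pi * r ^+ 2 by rewrite mulr_gt0 ?pi_gt0 ?exprn_gt0.
rewrite area_disc // [fine (_ * _)%:E]/=.
apply: (@le_trans _ _ (hexd * (pi * (r + 3) ^+ 2) / (pi * r ^+ 2))).
  rewrite ler_pM2r ?invr_gt0 // -lee_fin fineK; last exact: area_covered_fin.
  exact: area_covered_le.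
rewrite disc_ratioE // lerD2l.
have er : 15 * hexd / r <= e.
  rewrite ler_pdivrMr // [e * r]mulrC -ler_pdivrMr //; lra.
apply: le_trans er; rewrite (_ : 15 * hexd / r = hexd * (15 / r)) ?ler_pM2l //; last by ring.
have -> : 15 / r = 2 * 3 / r + 9 / r by field; rewrite gt_eqF.
rewrite lerD2l (_ : 3 ^+ 2 = 9) ?ler_pM2l //; last by ring.
by rewrite lef_pV2 ?posrE ?exprn_gt0 // expr2 ler_peMl // ltW.
Qed.

Lemma packing_density_ge C (t : R * R -> R) : unit_separated C ->
  \bigcup_(c in C) hexagon c (t c) = setT ->
  (hexd%:E <= packing_density C)%E.
Proof.
move=> sC Ct; apply: limf_esup_pinfty_ge => e e0.
(* The 3 keeps [r - 3] positive; the relative loss 6 / r - 9 / r^2 is at most 6 / r. *)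
exists (3 + 6 * hexd / e) => r re.
have d0 : 0 < 6 * hexd / e by rewrite divr_gt0 // mulr_gt0.
have r3 : 3 < r by lra.
have r0 : 0 < r by lra.
have A0 : 0 < pi * r ^+ 2 by rewrite mulr_gt0 ?pi_gt0 ?exprn_gt0.
rewrite area_disc // [fine (_ * _)%:E]/=.
apply: (@le_trans _ _ (hexd * (pi * (r + (- 3)) ^+ 2) / (pi * r ^+ 2))); last first.
  rewrite ler_pM2r ?invr_gt0 // -lee_fin fineK; last exact: area_covered_fin.
  exact: area_covered_ge sC Ct r3.
rewrite disc_ratioE // lerD2l.
have er : 6 * hexd / r <= e.
  rewrite ler_pdivrMr // [e * r]mulrC -ler_pdivrMr //; lra.
rewrite lerNl; apply: le_trans er; rewrite -mulrN (_ : 6 * hexd / r = hexd * (6 / r)) ?ler_pM2l //; last by ring.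
have : 0 <= (- 3) ^+ 2 / r ^+ 2 by rewrite divr_ge0 ?sqr_ge0.
have -> : 6 / r = - (2 * (- 3) / r) by field; rewrite gt_eqF.
lra.
Qed.
End density.

Theorem mainTheorem2 (R : realType) :
  (exists C : set (R * R), regular_hexagon_packing C) /\
  (forall C : set (R * R), regular_hexagon_packing C ->
     unit_circle_packing C /\
     packing_density C = (pi / Num.sqrt 12)%:E) /\
  (forall C : set (R * R), unit_circle_packing C ->
     (packing_density C <= (pi / Num.sqrt 12)%:E)%E).
Proof.
split; first by exists hexagonal_lattice; exact: hexagonal_lattice_packing.
have density_le C : unit_circle_packing C ->
    (packing_density C <= (pi / Num.sqrt 12 : R)%:E)%E.
  by move=> /packing_unit_separated; exact: packing_density_le.
split=> // C hC; have pC := regular_hexagon_packing_is_packing hC; split=> //.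
apply/le_anti/andP; split; first exact: density_le.
case: hC => t [Ct _].
exact: packing_density_ge (packing_unit_separated pC) Ct.
Qed.
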